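(* Let $K$ be a closed convex cone of positive linear maps in $H(M_A,M_B)$. The following are equivalent: (i) $K$ is a right-mapping cone. (ii) $K^*$ is a left-mapping cone. (iii) For all $\phi\in H(M_A,M_B)$: $\phi\in K^\circ$ if and only if $\psi^*\circ\phi\in\mathbb{CP}_A$ for every $\psi\in K$. (iv) For all $\phi\in H(M_A,M_B)$: $\phi\in K$ if and only if $\psi^*\circ\phi\in\mathbb{CP}_A$ for every $\psi\in K^\circ$. The following are also equivalent: (v) $K$ is a left-mapping cone. (vi) $K^*$ is a right-mapping cone. (vii) For all $\phi\in H(M_A,M_B)$: $\phi\in K^\circ$ if and only if $\phi\circ\psi^*\in\mathbb{CP}_B$ for every $\psi\in K$. (viii) For all $\phi\in H(M_A,M_B)$: $\phi\in K$ if and only if $\phi\circ\psi^*\in\mathbb{CP}_B$ for every $\psi\in K^\circ$.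
   Context: $M_A, M_B$ are the full complex matrix algebras acting on finite-dimensional Hilbert spaces $\mathbb C^A,\mathbb C^B$. $H(M_A,M_B)$ is the real vector space of Hermitian-preserving linear maps $M_A\to M_B$, i.e. those with $\phi(a^* )=\phi(a)^*$ for all $a$. On a matrix algebra use the bilinear pairing $\langle a,b\rangle=\operatorname{Tr}(a^{\mathrm t}b)=\sum_{i,j}a_{ij}b_{ij}$ ($\mathrm t$ is transpose; no complex conjugation). The adjoint $\phi^*:M_B\to M_A$ of a linear map $\phi:M_A\to M_B$ is defined with respect to this pairing: $\langle\phi(a),b\rangle=\langle a,\phi^*(b)\rangle$ for all $a\in M_A$, $b\in M_B$. The bilinear pairing on maps is $\langle\phi,\psi\rangle=\sum_{i,j}\langle\phi(e_{ij}),\psi(e_{ij})\rangle$, with $e_{ij}$ the matrix units of $M_A$. For a subset $K\subset H(M_A,M_B)$: $K^\circ=\{\psi\in H(M_A,M_B):\langle\phi,\psi\rangle\ge 0\text{ for every }\phi\in K\}$ and $K^*=\{\phi^*:\phi\in K\}\subset H(M_B,M_A)$. For sets of maps, $K_1\circ K_0=\{\phi_1\circ\phi_0:\phi_1\in K_1,\phi_0\in K_0\}$. $\mathbb{CP}_A$ (resp. $\mathbb{CP}_B$) is the convex cone of completely positive linear maps $M_A\to M_A$ (resp. $M_B\to M_B$). A closed convex cone $K$ of positive linear maps in $H(M_A,M_B)$ is a left-mapping cone if $\mathbb{CP}_B\circ K\subset K$, and a right-mapping cone if $K\circ\mathbb{CP}_A\subset K$ (and analogously in $H(M_B,M_A)$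 with the roles of $A$ and $B$ exchanged). *)

(* Defs.v *)
From HB Require Import structures.
From mathcomp Require Import all_boot all_order all_algebra.
From mathcomp Require Import complex.
From mathcomp Require Import classical_sets reals topology normedtype.

Set Implicit Arguments.
Unset Strict Implicit.
Unset Printing Implicit Defensive.

Import Order.TTheory GRing.Theory Num.Theory.
Import numFieldNormedType.Exports.

Local Open Scope classical_set_scope.
Local Open Scope ring_scope.
Local Open Scope sesquilinear_scope.
Local Open Scope complex_scope.

(* The complex numbers are [R[i]] with [R : realType]. In the order of [R[i]],
   [0 <= z] means that [z] is real and nonnegative. *)

#[export, non_forgetful_inheritance]
HB.instance Definition _ (R : realType) := NormedModule.copy R[i] R[i]^o.

Section Pairing.
Variables (R : realType) (m n : nat).
Local Notation C := (R[i]).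
Implicit Types phi psi : 'Hom('M[C]_m, 'M[C]_n).

(* Bilinear: there is no complex conjugation. *)
Definition mxpair (k : nat) (a b : 'M[C]_k) : C := \tr (a^T *m b).

Definition hompair phi psi : C :=
  \sum_(i < m) \sum_(j < m) mxpair (phi (delta_mx i j)) (psi (delta_mx i j)).

(* The (i, j) entry of phi^*(b) is <e_ij, phi^*(b)> = <phi(e_ij), b>; see
   [hom_adjointP] and [hom_adjoint_unique] for the defining property. *)
Definition hom_adjoint phi : 'Hom('M[C]_n, 'M[C]_m) :=
  linfun (fun b => \matrix_(i, j) mxpair (phi (delta_mx i j)) b).

Definition hermitian_preserving phi : Prop :=
  forall a : 'M[C]_m, phi (a ^t*) = (phi a) ^t*.

End Pairing.

Section AdjointTheory.
Variables (R : realType).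
Local Notation C := (R[i]).

Lemma mxpairE (k : nat) (a b : 'M[C]_k) :
  mxpair a b = \sum_(i < k) \sum_(j < k) a i j * b i j.
Proof.
rewrite /mxpair /mxtrace exchange_big /=; apply: eq_bigr => i _.
by rewrite mxE; apply: eq_bigr => j _; rewrite mxE.
Qed.

Lemma mxpair_delta (k : nat) (i j : 'I_k) (b : 'M[C]_k) :
  mxpair (delta_mx i j) b = b i j.
Proof.
rewrite mxpairE (bigD1 i) //= (bigD1 j) //= mxE !eqxx mul1r.
rewrite big1 => [|j' /negbTE nj]; last by rewrite mxE nj andbF mul0r.
rewrite big1 => [|i' /negbTE ni]; first by rewrite !addr0.
by rewrite big1 // => j' _; rewrite mxE ni mul0r.
Qed.

Lemma mxpairDl (k : nat) (a a' b : 'M[C]_k) :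
  mxpair (a + a') b = mxpair a b + mxpair a' b.
Proof. by rewrite /mxpair linearD mulmxDl linearD. Qed.

Lemma mxpairZl (k : nat) c (a b : 'M[C]_k) :
  mxpair (c *: a) b = c * mxpair a b.
Proof. by rewrite /mxpair linearZ -scalemxAl linearZ. Qed.

Lemma hom_adjointE (m n : nat) (phi : 'Hom('M[C]_m, 'M[C]_n)) b :
  hom_adjoint phi b = \matrix_(i, j) mxpair (phi (delta_mx i j)) b.
Proof.
pose f (b : 'M[C]_n) : 'M[C]_m :=
  \matrix_(i, j) mxpair (phi (delta_mx i j)) b.
have fL : linear f.
  move=> c x y; apply/matrixP => i j; rewrite !mxE.
  by rewrite /mxpair mulmxDr -scalemxAr linearD linearZ.
pose F := GRing.isLinear.Build _ _ _ _ f fL.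
pose G : {linear 'M[C]_n -> 'M[C]_m} := HB.pack f F.
exact: (lfunE G).
Qed.

Lemma hom_adjointP (m n : nat) (phi : 'Hom('M[C]_m, 'M[C]_n)) a b :
  mxpair (phi a) b = mxpair a (hom_adjoint phi b).
Proof.
rewrite hom_adjointE [RHS]mxpairE {1}(matrix_sum_delta a) linear_sum /=.
have mxpair_suml I (r : seq I) (F : I -> 'M[C]_n) :
    mxpair (\sum_(i <- r) F i) b = \sum_(i <- r) mxpair (F i) b.
  elim: r => [|i r IH]; last by rewrite !big_cons mxpairDl IH.
  by rewrite !big_nil /mxpair linear0 mul0mx linear0.
rewrite mxpair_suml; apply: eq_bigr => i _.
rewrite linear_sum mxpair_suml; apply: eq_bigr => j _.
by rewrite linearZ /= mxpairZl mxE.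
Qed.

Lemma hom_adjoint_unique (m n : nat) (phi : 'Hom('M[C]_m, 'M[C]_n))
    (chi : 'Hom('M[C]_n, 'M[C]_m)) :
  (forall a b, mxpair (phi a) b = mxpair a (chi b)) -> chi = hom_adjoint phi.
Proof.
move=> chiP; apply/lfunP => b; apply/matrixP => i j.
by rewrite -mxpair_delta -chiP hom_adjointP mxpair_delta.
Qed.

End AdjointTheory.

Section Positivity.
Variables (R : realType).
Local Notation C := (R[i]).

Definition psdmx (n : nat) (a : 'M[C]_n) : Prop :=
  a \is hermsymmx /\ forall x : 'cV[C]_n, 0 <= (x ^t* *m a *m x) 0 0.

Definition positive_map (m n : nat) (phi : 'Hom('M[C]_m, 'M[C]_n)) : Prop :=
  forall a : 'M[C]_m, psdmx a -> psdmx (phi a).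

(* id_k (x) phi, acting on k x k block matrices with blocks in 'M[C]_m. *)
Definition ampliation (m n k : nat) (phi : 'Hom('M[C]_m, 'M[C]_n))
    (x : 'M[C]_(\sum_(i < k) m)) : 'M[C]_(\sum_(i < k) n) :=
  \mxblock_(i < k, j < k) phi (submxblock x i j).

Definition completely_positive (m n : nat)
    (phi : 'Hom('M[C]_m, 'M[C]_n)) : Prop :=
  forall (k : nat) (x : 'M[C]_(\sum_(i < k) m)),
    psdmx x -> psdmx (ampliation phi x).

Definition CP (n : nat) : set 'Hom('M[C]_n, 'M[C]_n) :=
  [set phi | completely_positive phi].

End Positivity.
Arguments CP : clear implicits.

Section Cones.
Variables (R : realType).
Local Notation C := (R[i]).

Definition hermitian_maps (m n : nat) : set 'Hom('M[C]_m, 'M[C]_n) :=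
  [set phi | hermitian_preserving phi].

(* ['Hom(_, _)] carries no topology in the library, so it is transported along
   the linear isomorphism [lin_mx] sending a map to its matrix in the bases of
   matrix units. Since [hermitian_maps] is a closed real subspace, being closed
   in it or in the whole space of linear maps is the same. *)
Definition hom_closed (m n : nat) (K : set 'Hom('M[C]_m, 'M[C]_n)) : Prop :=
  closed [set lin_mx phi | phi in K].

(* A convex cone contains 0, hence is nonempty. *)
Definition convex_cone (m n : nat) (K : set 'Hom('M[C]_m, 'M[C]_n)) : Prop :=
  [/\ K 0,
      forall phi psi, K phi -> K psi -> K (phi + psi)
    & forall (c : R) phi, 0 <= c -> K phi -> K (c%:C *: phi)].

Definition closed_convex_cone_of_positive_maps (m n : nat)
    (K : set 'Hom('M[C]_m, 'M[C]_n)) : Prop :=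
  [/\ K `<=` @hermitian_maps m n, K `<=` @positive_map R m n,
      convex_cone K & hom_closed K].

Definition dual_cone (m n : nat) (K : set 'Hom('M[C]_m, 'M[C]_n)) :
    set 'Hom('M[C]_m, 'M[C]_n) :=
  [set psi | hermitian_maps psi /\ forall phi, K phi -> 0 <= hompair phi psi].

Definition adjoint_set (m n : nat) (K : set 'Hom('M[C]_m, 'M[C]_n)) :
    set 'Hom('M[C]_n, 'M[C]_m) :=
  [set hom_adjoint phi | phi in K].

Definition comp_set (m n p : nat) (K1 : set 'Hom('M[C]_n, 'M[C]_p))
    (K0 : set 'Hom('M[C]_m, 'M[C]_n)) : set 'Hom('M[C]_m, 'M[C]_p) :=
  [set (phi1 \o phi0)%VF | phi1 in K1 & phi0 in K0].

Definition left_mapping_cone (m n : nat)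
    (K : set 'Hom('M[C]_m, 'M[C]_n)) : Prop :=
  closed_convex_cone_of_positive_maps K /\ comp_set (CP R n) K `<=` K.

Definition right_mapping_cone (m n : nat)
    (K : set 'Hom('M[C]_m, 'M[C]_n)) : Prop :=
  closed_convex_cone_of_positive_maps K /\ comp_set K (CP R m) `<=` K.

End Cones.

(* Main.v *)
Require Import Defs.
From HB Require Import structures.
From mathcomp Require Import all_boot all_order all_algebra.
From mathcomp Require Import complex.
From mathcomp Require Import boolp classical_sets reals topology normedtype derive.
From mathcomp Require Import ring lra.

(** In the trace pairing, left composition by [beta] has adjoint left
    composition by [beta^*], so [<psi o alpha, phi> = <alpha, psi^* o phi>].
    Since [CP] is its own dual cone, [phi] is in the dual of [K o CP] iff every
    [psi^* o phi] is completely positive, and when [K o CP] is contained in [K]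
    the dual of [K o CP] is the dual of [K]. The passage between [K] and its dual is the bipolar
    theorem. The statements on left-mapping cones are those on right-mapping
    cones for [K^*].

    The self-duality of [CP] is read off a criterion: [beta] is completely
    positive iff it pairs nonnegatively with all the maps [a |-> V a V^*].
    Necessity tests the Choi matrix of [beta] on the vector with blocks the
    conjugated columns of [V]; for sufficiency one decomposes a positive block
    matrix into rank one terms [w w^*], with blocks [w_p w_q^*], and finds that
    the form of [beta] applied blockwise, at the vector with blocks [z_p], is
    the pairing with [V = sum_p conj(z_p) w_p^T]. *)

Set Implicit Arguments.
Unset Strict Implicit.
Unset Printing Implicit Defensive.

Import Order.TTheory GRing.Theory Num.Theory.
Import numFieldNormedType.Exports.

Local Open Scope classical_set_scope.
Local Open Scope ring_scope.
Local Open Scope sesquilinear_scope.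

(** * Positive semidefinite matrices *)

Section PsdMatrices.
Variable R : realType.
Local Notation C := (R[i]).

Lemma ctrmx_mul m n p (A : 'M[C]_(m, n)) (B : 'M[C]_(n, p)) :
  (A *m B)^t* = B^t* *m A^t*.
Proof. by rewrite trmx_mul map_mxM. Qed.

Lemma ctrmxD m n (A B : 'M[C]_(m, n)) : (A + B)^t* = A^t* + B^t*.
Proof. by rewrite linearD /= map_mxD. Qed.

Lemma ctrmxZ m n c (A : 'M[C]_(m, n)) : (c *: A)^t* = c^* *: A^t*.
Proof. by apply/matrixP => i j; rewrite !mxE rmorphM. Qed.

Lemma ctrmx_sum m n I (r : seq I) (F : I -> 'M[C]_(m, n)) :
  (\sum_(i <- r) F i)^t* = \sum_(i <- r) (F i)^t*.
Proof. by rewrite linear_sum raddf_sum. Qed.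

Lemma ctrmx_delta m n i j :
  (delta_mx i j : 'M[C]_(m, n))^t* = delta_mx j i.
Proof. by apply/matrixP => k l; rewrite !mxE andbC conjC_nat. Qed.

Lemma hermsymmxP n (a : 'M[C]_n) : reflect (a^t* = a) (a \is hermsymmx).
Proof.
apply: (iffP idP) => [/is_hermitianmxP|] e; first by rewrite {2}e expr0 scale1r.
by apply/is_hermitianmxP; rewrite expr0 scale1r.
Qed.

Lemma form_delta n (a : 'M[C]_n) i j c :
  let x := delta_mx i 0 + c *: delta_mx j 0 : 'cV[C]_n in
  (x^t* *m a *m x) 0 0 = a i i + c * a i j + c^* * a j i + c^* * c * a j j.
Proof.
have E k l : (delta_mx k 0 : 'cV[C]_n)^t* *m a *m (delta_mx l 0 : 'cV[C]_n)
    = (a k l)%:M.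
  by apply/matrixP => p q; rewrite !ord1 ctrmx_delta -rowE -colE !mxE mulr1n.
rewrite /= ctrmxD ctrmxZ mulmxDl mulmxDr !mulmxDl -!scalemxAr -!scalemxAl !E.
by rewrite !mxE !mulr1n; ring.
Qed.

(** Polarization: a form with real values equals its conjugate, and comparing the two at
    [e_i + c e_j] forces the matrix to be Hermitian. Positivity proofs below then test the form
    alone. *)
Lemma nonneg_form_psdmx n (a : 'M[C]_n) :
  (forall x : 'cV[C]_n, 0 <= (x^t* *m a *m x) 0 0) -> psdmx a.
Proof.
move=> a_ge0; split=> //; apply/hermsymmxP/matrixP => i j; rewrite !mxE.
pose D k l := (a k l)^* - a l k.
have formC (x : 'cV[C]_n) : (x^t* *m a *m x) 0 0 = ((x^t* *m a *m x) 0 0)^* .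
  by rewrite conj_Creal // ger0_real.
have Dii k : D k k = 0.
  have := formC (delta_mx k 0 + 0 *: delta_mx k 0).
  rewrite form_delta conjC0 !(mul0r, addr0) => e.
  by apply/eqP; rewrite subr_eq0 -e.
have H c : c * D j i + c^* * D i j = 0.
  move: (formC (delta_mx i 0 + c *: delta_mx j 0)).
  rewrite form_delta !rmorphD !rmorphM /= conjCK => /eqP.
  have /eqP := Dii i; have /eqP := Dii j; rewrite !subr_eq0 => /eqP -> /eqP ->.
  rewrite -!addrA (inj_eq (addrI _)) [c * c^*]mulrC !addrA (inj_eq (addIr _)).
  by rewrite -subr_eq0 -oppr_eq0 => /eqP <-; rewrite /D; ring.
(* [c = 1] makes the two defects opposite and [c = 'i] makes them equal, so both vanish. *)
have := H 1; have := H 'i; rewrite conjC1 conjCi !mul1r mulNr -mulrBr.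
move=> /eqP; rewrite mulf_eq0 (negbTE (neq0Ci _)) /= subr_eq0 => /eqP -> /eqP.
by rewrite -mulr2n mulrn_eq0 /= subr_eq0 => /eqP <-; rewrite conjCK.
Qed.

Lemma psdmx_gram n m (W : 'M[C]_(n, m)) : psdmx (W *m W^t*).
Proof.
apply: nonneg_form_psdmx => x.
have -> : x^t* *m (W *m W^t*) *m x = x^t* *m W *m (x^t* *m W)^t*.
  by rewrite ctrmx_mul trmxCK !mulmxA.
by rewrite mxE sumr_ge0 // => k _; rewrite !mxE mul_conjC_ge0.
Qed.

(** Spectral theorem, with the square roots of the eigenvalues absorbed in [W]. *)
Lemma psdmx_factor n (a : 'M[C]_n) :
  psdmx a -> exists W : 'M[C]_n, a = W *m W^t*.
Proof.
move=> [ha a_ge0].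
have /orthomx_spectralP := hermitian_normalmx ha.
set P := spectralmx a; set d := spectral_diag a => a_eq.
have uP : P \is unitarymx by exact: spectral_unitarymx.
(* An eigenvalue is the value of the form at the unit eigenvector [P^t* e_i]. *)
have d_ge0 i : 0 <= d 0 i.
  have := a_ge0 (P^t* *m delta_mx i 0).
  rewrite ctrmx_mul trmxCK [in X in X -> _]a_eq (invmx_unitary uP) !mulmxA.
  by rewrite !(mulmxtVK _ uP) ctrmx_delta -rowE -colE !mxE eqxx mulr1n.
pose s := \row_i sqrtC (d 0 i).
exists (invmx P *m diag_mx s); rewrite ctrmx_mul (invmx_unitary uP) trmxCK.
rewrite {1}a_eq (invmx_unitary uP) !mulmxA; congr (_ *m _).
rewrite -!mulmxA; congr (_ *m _).
rewrite tr_diag_mx map_diag_mx mulmx_diag; congr diag_mx.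
by apply/rowP => i; rewrite !mxE /= geC0_conj ?sqrtC_ge0 // -expr2 sqrtCK.
Qed.

(** For [a = W W^*] the pairing is the sum of the values of the form of [b] at the conjugated
    columns of [W]. *)
Lemma mxpair_psdmx_ge0 n (a b : 'M[C]_n) :
  psdmx a -> psdmx b -> 0 <= mxpair a b.
Proof.
move=> /psdmx_factor [W ->] [_ b_ge0].
rewrite /mxpair trmx_mul -mulmxA mxtrace_mulC -mulmxA.
apply: sumr_ge0 => k _.
have := b_ge0 ((W^t*)^T *m delta_mx k 0); rewrite ctrmx_mul.
have -> : ((W^t*)^T)^t* = W^T by apply/matrixP => i j; rewrite !mxE conjCK.
by rewrite ctrmx_delta -!mulmxA -rowE !mulmxA -colE !mxE.
Qed.

End PsdMatrices.

(** * The pairing and completely positive maps *)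

Section Pairing.
Variable R : realType.
Local Notation C := (R[i]).

Lemma mxpairC n (a b : 'M[C]_n) : mxpair a b = mxpair b a.
Proof.
rewrite !mxpairE; apply: eq_bigr => i _; apply: eq_bigr => j _.
exact: mulrC.
Qed.

Lemma mxpairDr n (a b b' : 'M[C]_n) :
  mxpair a (b + b') = mxpair a b + mxpair a b'.
Proof. by rewrite mxpairC mxpairDl !(mxpairC _ a). Qed.

Lemma mxpairZr n c (a b : 'M[C]_n) : mxpair a (c *: b) = c * mxpair a b.
Proof. by rewrite mxpairC mxpairZl mxpairC. Qed.

Lemma mxpair_ctrmx n (a b : 'M[C]_n) : mxpair (a^t*) (b^t*) = (mxpair a b)^*.
Proof.
rewrite !mxpairE exchange_big rmorph_sum; apply: eq_bigr => i _ /=.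
by rewrite rmorph_sum; apply: eq_bigr => j _; rewrite !mxE rmorphM.
Qed.

Lemma hom_adjoint_delta m n (phi : 'Hom('M[C]_m, 'M[C]_n)) k l i j :
  hom_adjoint phi (delta_mx k l) i j = phi (delta_mx i j) k l.
Proof. by rewrite hom_adjointE mxE mxpairC mxpair_delta. Qed.

Lemma hom_adjointK m n (phi : 'Hom('M[C]_m, 'M[C]_n)) :
  hom_adjoint (hom_adjoint phi) = phi.
Proof.
apply/esym/hom_adjoint_unique => a b.
by rewrite mxpairC -hom_adjointP mxpairC.
Qed.

Lemma hom_adjoint_comp m n p (psi : 'Hom('M[C]_n, 'M[C]_p))
    (phi : 'Hom('M[C]_m, 'M[C]_n)) :
  hom_adjoint (psi \o phi)%VF = (hom_adjoint phi \o hom_adjoint psi)%VF.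
Proof.
by apply/esym/hom_adjoint_unique => a b; rewrite !comp_lfunE !hom_adjointP.
Qed.

Lemma hom_adjointD m n (phi psi : 'Hom('M[C]_m, 'M[C]_n)) :
  hom_adjoint (phi + psi) = hom_adjoint phi + hom_adjoint psi.
Proof.
apply/esym/hom_adjoint_unique => a b.
by rewrite !add_lfunE mxpairDl mxpairDr !hom_adjointP.
Qed.

Lemma hom_adjointZ m n c (phi : 'Hom('M[C]_m, 'M[C]_n)) :
  hom_adjoint (c *: phi) = c *: hom_adjoint phi.
Proof.
apply/esym/hom_adjoint_unique => a b.
by rewrite !scale_lfunE mxpairZl mxpairZr !hom_adjointP.
Qed.

Lemma hom_adjoint0 m n : hom_adjoint (0 : 'Hom('M[C]_m, 'M[C]_n)) = 0.
Proof. by rewrite -[X in hom_adjoint X](scale0r 0) hom_adjointZ scale0r. Qed.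

Lemma hompairC m n (phi psi : 'Hom('M[C]_m, 'M[C]_n)) :
  hompair phi psi = hompair psi phi.
Proof. by apply: eq_bigr => i _; apply: eq_bigr => j _; exact: mxpairC. Qed.

Lemma hompairE m n (phi psi : 'Hom('M[C]_m, 'M[C]_n)) :
  hompair phi psi = \sum_(p : 'I_m * 'I_m) \sum_(q : 'I_n * 'I_n)
    phi (delta_mx p.1 p.2) q.1 q.2 * psi (delta_mx p.1 p.2) q.1 q.2.
Proof.
rewrite /hompair pair_bigA; apply: eq_bigr => p _.
by rewrite mxpairE pair_bigA.
Qed.

Lemma hompair_adjoint m n (phi psi : 'Hom('M[C]_m, 'M[C]_n)) :
  hompair (hom_adjoint phi) (hom_adjoint psi) = hompair phi psi.
Proof.
rewrite !hompairE exchange_big; apply: eq_bigr => p _; apply: eq_bigr => q _.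
by rewrite !hom_adjoint_delta.
Qed.

Lemma hompair_compl m n p (beta : 'Hom('M[C]_n, 'M[C]_p))
    (phi : 'Hom('M[C]_m, 'M[C]_n)) psi :
  hompair (beta \o phi)%VF psi = hompair phi (hom_adjoint beta \o psi)%VF.
Proof.
apply: eq_bigr => i _; apply: eq_bigr => j _.
by rewrite !comp_lfunE hom_adjointP.
Qed.

Lemma hermitian_preserving_delta m n (phi : 'Hom('M[C]_m, 'M[C]_n)) i j :
  hermitian_preserving phi -> (phi (delta_mx i j))^t* = phi (delta_mx j i).
Proof. by move=> <-; rewrite ctrmx_delta. Qed.

Lemma hermitian_adjoint m n (phi : 'Hom('M[C]_m, 'M[C]_n)) :
  hermitian_preserving phi -> hermitian_preserving (hom_adjoint phi).
Proof.
move=> hphi b; apply/matrixP => i j; rewrite !mxE !hom_adjointE !mxE.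
by rewrite -mxpair_ctrmx hermitian_preserving_delta.
Qed.

Lemma hermitian_comp m n p (psi : 'Hom('M[C]_n, 'M[C]_p))
    (phi : 'Hom('M[C]_m, 'M[C]_n)) :
  hermitian_preserving psi -> hermitian_preserving phi ->
  hermitian_preserving (psi \o phi)%VF.
Proof. by move=> hpsi hphi a; rewrite !comp_lfunE hphi hpsi. Qed.

(** With [y] the conjugate of [x], the form at [x] is the pairing of [b] with the image under [phi]
    of [y *m y^t*]: two positive matrices are paired. *)
Lemma positive_adjoint m n (phi : 'Hom('M[C]_m, 'M[C]_n)) :
  positive_map phi -> positive_map (hom_adjoint phi).
Proof.
move=> pphi b b_psd; apply: nonneg_form_psdmx => x.
pose y : 'cV[C]_m := (x^t*)^T.
have -> : (x^t* *m hom_adjoint phi b *m x) 0 0 =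
    mxpair (y *m y^t*) (hom_adjoint phi b).
  rewrite /mxpair trmx_mul mxtrace_mulC mulmxA.
  have -> : (y^t*)^T = x by apply/matrixP => i j; rewrite !mxE conjCK.
  by rewrite mxtrace_mulC mulmxA trmxK trace_mx11.
rewrite -hom_adjointP; apply: mxpair_psdmx_ge0 => //.
exact/pphi/psdmx_gram.
Qed.

End Pairing.

(** * Choi matrices and a criterion for complete positivity *)

Section CompletelyPositive.
Variable R : realType.
Local Notation C := (R[i]).

Definition conj_map m n (V : 'M[C]_(n, m)) : 'Hom('M[C]_m, 'M[C]_n) :=
  linfun (mulmxr (V^t*) \o mulmx V).

Lemma conj_mapE m n (V : 'M[C]_(n, m)) a : conj_map V a = V *m a *m V^t*.
Proof. by rewrite lfunE. Qed.

Lemma ctrmx_mxcol k n p (z : 'M[C]_(\sum_(i < k) n, p)) :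
  z^t* = \mxrow_i (submxcol z i)^t*.
Proof.
by apply/mxrowP => i; rewrite mxrowK; apply/matrixP => r s; rewrite !mxE.
Qed.

Lemma block_form k n (B : 'I_k -> 'I_k -> 'M[C]_n)
    (z : 'cV[C]_(\sum_(i < k) n)) :
  z^t* *m (\mxblock_(i < k, j < k) B i j) *m z =
  \sum_i \sum_j (submxcol z i)^t* *m B i j *m submxcol z j.
Proof.
rewrite -[X in _ *m X = _]submxcolK ctrmx_mxcol.
rewrite mul_mxrow_mxblock mul_mxrow_mxcol.
rewrite [RHS]exchange_big.
by apply: eq_bigr => i _; rewrite mulmx_suml.
Qed.

(** With [v_i] the columns of [V], [V e_ij V^*] is [v_i v_j^*], whose bilinear pairing with [b] is
    [v_i^T b conj(v_j)]. Hence the Choi matrix of [beta] is tested on the conjugated columns. *)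
Lemma hompair_conj_map m n (V : 'M[C]_(n, m)) (beta : 'Hom('M[C]_m, 'M[C]_n)) :
  let z i := map_mx Num.conj (col i V) in
  hompair (conj_map V) beta =
  (\sum_i \sum_j (z i)^t* *m beta (delta_mx i j) *m z j) 0 0.
Proof.
move=> z; rewrite summxE; apply: eq_bigr => i _; rewrite summxE.
apply: eq_bigr => j _.
have zE k : z k = map_mx Num.conj V *m delta_mx k 0 by rewrite /z map_col -colE.
have -> : delta_mx i j = delta_mx i 0 *m (delta_mx j 0 : 'cV[C]_m)^t*.
  by rewrite ctrmx_delta mul_delta_mx.
set b := beta _; have ztC k : (z k)^t* = (V *m delta_mx k 0)^T.
  by rewrite -colE; apply/matrixP => p q; rewrite !mxE conjCK.
rewrite ztC conj_mapE /mxpair.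
have -> : V *m (delta_mx i 0 *m (delta_mx j 0 : 'cV[C]_m)^t*) *m V^t* =
    V *m delta_mx i 0 *m (z j)^T.
  rewrite -!mulmxA; congr (_ *m (_ *m _)); rewrite zE trmx_mul.
  by rewrite map_trmx ctrmx_delta trmx_delta.
by rewrite trmx_mul trmxK -!mulmxA mxtrace_mulC trace_mx11 mulmxA.
Qed.

Lemma hom_adjoint_conj_map m n (V : 'M[C]_(n, m)) :
  hom_adjoint (conj_map V) = conj_map V^T.
Proof.
apply/esym/hom_adjoint_unique => a b.
have e : (V^t*)^T = V^T^t* by apply/matrixP => i j; rewrite !mxE.
by rewrite !conj_mapE /mxpair !trmx_mul e -!mulmxA mxtrace_mulC !mulmxA.
Qed.

Lemma completely_positive_comp m n p (psi : 'Hom('M[C]_n, 'M[C]_p))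
    (phi : 'Hom('M[C]_m, 'M[C]_n)) :
  completely_positive psi -> completely_positive phi ->
  completely_positive (psi \o phi)%VF.
Proof.
move=> cpsi cphi k x /cphi/cpsi.
have -> // : ampliation psi (ampliation phi x) = ampliation (psi \o phi)%VF x.
by apply: eq_mxblock => i j; rewrite comp_lfunE mxblockK.
Qed.

(** This Choi matrix of the identity is [w w^*], with [w] the unnormalized maximally entangled
    vector. *)
Lemma psdmx_choi_id m :
  psdmx (\mxblock_(i < m, j < m) (delta_mx i j : 'M[C]_m)).
Proof.
pose w : 'cV[C]_(\sum_(i < m) m) := \mxcol_i delta_mx i 0.
have -> : \mxblock_(i < m, j < m) (delta_mx i j : 'M[C]_m) = w *m w^t*.
  have -> : w^t* = \mxrow_i (delta_mx 0 i : 'rV[C]_m).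
    rewrite ctrmx_mxcol; apply: eq_mxrow => i.
    by rewrite mxcolK ctrmx_delta.
  rewrite mul_mxcol_mxrow; apply: eq_mxblock => i j.
  by rewrite mul_delta_mx.
exact: psdmx_gram.
Qed.

Lemma completely_positive_choi m n (phi : 'Hom('M[C]_m, 'M[C]_n)) :
  completely_positive phi -> psdmx (\mxblock_(i < m, j < m) phi (delta_mx i j)).
Proof.
move=> /(_ m _ (psdmx_choi_id m)).
rewrite /ampliation; congr psdmx.
by apply: eq_mxblock => i j; rewrite mxblockK.
Qed.

(** The Choi matrix is Hermitian; comparing its blocks gives the relation on matrix units, and
    linearity extends it. *)
Lemma completely_positive_hermitian m n (phi : 'Hom('M[C]_m, 'M[C]_n)) :
  completely_positive phi -> hermitian_preserving phi.
Proof.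
move=> /completely_positive_choi [/hermsymmxP hphi _] a.
have phi_delta i j : (phi (delta_mx i j))^t* = phi (delta_mx j i).
  have := congr1 (fun M => submxblock M j i) hphi.
  rewrite mxblockK => <-.
  rewrite -[phi (delta_mx i j)](mxblockK (fun i j => phi (delta_mx i j))).
  by apply/matrixP => k l; rewrite !mxE.
have phiE b : phi b = \sum_i \sum_j b i j *: phi (delta_mx i j).
  rewrite {1}(matrix_sum_delta b) linear_sum; apply: eq_bigr => i _.
  by rewrite linear_sum; apply: eq_bigr => j _; rewrite linearZ.
rewrite !phiE ctrmx_sum exchange_big; apply: eq_bigr => i _.
rewrite ctrmx_sum; apply: eq_bigr => j _.
by rewrite ctrmxZ phi_delta !mxE.
Qed.

Lemma completely_positiveP m n (beta : 'Hom('M[C]_m, 'M[C]_n)) :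
  completely_positive beta <-> forall V, 0 <= hompair (conj_map V) beta.
Proof.
split=> [/completely_positive_choi [_ beta_ge0] V|
  beta_ge0 k x /psdmx_factor [W ->]].
  rewrite hompair_conj_map; pose z i := map_mx Num.conj (col i V).
  have := beta_ge0 (\mxcol_i z i); rewrite block_form.
  by under eq_bigr do under eq_bigr do rewrite !mxcolK.
apply: nonneg_form_psdmx => z.
rewrite block_form.
(* [r] runs over the columns of [W], that is, over the rank one terms; [z' r] stacks the conjugated
   columns of the matrix [V r] chosen below. *)
pose z' r i := \sum_p (submxcol W p i r)^* *: submxcol z p.
have -> : \sum_i \sum_j (submxcol z i)^t* *m
      beta (submxblock (W *m W^t*) i j) *m submxcol z j
  = \sum_r \sum_i \sum_j (z' r i)^t* *m beta (delta_mx i j) *m z' r j.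
  have exchange_big3 (I J L : finType) (F : I -> J -> L -> 'M[C]_1) :
      \sum_p \sum_q \sum_r F r p q = \sum_r \sum_p \sum_q F r p q.
    by rewrite [RHS]exchange_big; apply: eq_bigr => p _; rewrite exchange_big.
  (* [G] is the common summand: expanding the blocks of [W W^*] on the left and the vectors [z'] on
     the right gives one five-fold sum in two orders. *)
  pose G p q r i j := (submxcol W p i r * (submxcol W q j r)^*) *:
    ((submxcol z p)^t* *m beta (delta_mx i j) *m submxcol z q).
  transitivity (\sum_p \sum_q \sum_r \sum_i \sum_j G p q r i j).
    apply: eq_bigr => p _; apply: eq_bigr => q _.
    rewrite [submxblock _ _ _]matrix_sum_delta -exchange_big3.
    rewrite linear_sum mulmx_sumr mulmx_suml; apply: eq_bigr => i _.
    rewrite linear_sum mulmx_sumr mulmx_suml; apply: eq_bigr => j _.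
    rewrite linearZ -scalemxAr -scalemxAl /G !mxE scaler_suml.
    by apply: eq_bigr => r _; rewrite !mxE.
  rewrite exchange_big3; apply: eq_bigr => r _.
  rewrite exchange_big3; apply: eq_bigr => i _.
  rewrite exchange_big3; apply: eq_bigr => j _.
  rewrite ctrmx_sum !mulmx_suml; apply: eq_bigr => p _.
  rewrite mulmx_sumr; apply: eq_bigr => q _.
  by rewrite ctrmxZ conjCK -scalemxAr -!scalemxAl scalerA mulrC.
rewrite summxE; apply: sumr_ge0 => r _.
pose V r := \matrix_(l, i) (z' r i l 0)^*.
have := beta_ge0 (V r).
rewrite hompair_conj_map.
have E s : map_mx Num.conj (col s (V r)) = z' r s.
  by apply/matrixP => p q; rewrite !mxE ord1 conjCK.
by under eq_bigr do under eq_bigr do rewrite !E.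
Qed.

End CompletelyPositive.

(** * Self-duality of the cone of completely positive maps *)

Section CPDuality.
Variable R : realType.
Local Notation C := (R[i]).

(** The ampliation is a congruence: its form at [z] is the form of [x] at the vector with blocks
    [V^* z_i]. *)
Lemma completely_positive_conj_map m n (V : 'M[C]_(n, m)) :
  completely_positive (conj_map V).
Proof.
move=> k x [_ x_ge0]; apply: nonneg_form_psdmx => z.
have := x_ge0 (\mxcol_i (V^t* *m submxcol z i)).
rewrite -{1}[x]submxblockK !block_form.
under eq_bigr do under eq_bigr do rewrite !mxcolK ctrmx_mul trmxCK.
by under [in X in _ -> X]eq_bigr do under eq_bigr do rewrite conj_mapE !mulmxA;
  under eq_bigr do under eq_bigr do rewrite !mulmxA.
Qed.

(** Adjunction preserves the pairing and permutes the test maps, replacing [V] by [V^T]. *)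
Lemma completely_positive_adjoint m n (beta : 'Hom('M[C]_m, 'M[C]_n)) :
  completely_positive beta -> completely_positive (hom_adjoint beta).
Proof.
move=> /completely_positiveP beta_ge0; apply/completely_positiveP => V.
by rewrite -[conj_map V]hom_adjointK hompair_adjoint hom_adjoint_conj_map.
Qed.

Lemma CP_dual n (beta : 'Hom('M[C]_n, 'M[C]_n)) :
  (forall alpha, CP R n alpha -> 0 <= hompair alpha beta) -> CP R n beta.
Proof.
move=> b0; apply/completely_positiveP => V.
exact/b0/completely_positive_conj_map.
Qed.

(** The identity is the test map for [V = 1]. As [<psi, phi> = <id, psi^* o phi>], this recovers a
    nonnegative pairing from complete positivity of [psi^* o phi]. *)
Lemma CP_hompair_id n (beta : 'Hom('M[C]_n, 'M[C]_n)) :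
  CP R n beta -> 0 <= hompair \1%VF beta.
Proof.
move=> /completely_positiveP /(_ 1%:M).
have -> // : conj_map 1%:M = \1%VF :> 'Hom('M[C]_n, 'M[C]_n).
apply/lfunP => a.
by rewrite conj_mapE id_lfunE trmx1 map_mx1 mul1mx mulmx1.
Qed.

End CPDuality.

(** * Separation of a point from a closed convex cone *)

Section ConeSeparation.
Variables (R : realType) (N : nat).

Lemma cone_separation (S : set 'rV[R]_N) (v : 'rV[R]_N) :
  closed S -> S 0 -> (forall x y, S x -> S y -> S (x + y)) ->
  (forall c x, 0 <= c -> S x -> S (c *: x)) -> ~ S v ->
  exists w : 'rV[R]_N, (forall s, S s -> 0 <= \sum_i w 0 i * s 0 i) /\
    \sum_i w 0 i * v 0 i < 0.
Proof.
move=> Scl S0 SD SZ nSv.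
(* The functional is [c - v], with [c] the point of [S] nearest to [v]. *)
pose dot (a b : 'rV[R]_N) := \sum_i a 0 i * b 0 i.
pose f (s : 'rV[R]_N) := \sum_i (s 0 i - v 0 i) ^+ 2.
have fcont : continuous f.
  apply: continuous_big => [|i _].
    exact: add_continuous.
  have coordB : continuous (fun s : 'rV[R]_N => s 0 i - v 0 i).
    move=> s.
    apply: (@continuousB _ _ _ (fun s : 'rV[R]_N => s 0 i) (fun=> v 0 i)).
      exact: coord_continuous.
    exact: cst_continuous.
  by move=> s; exact: (continuousM (coordB s) (coordB s)).
(* Points of [S] farther from [v] than [0] can be discarded; what remains is compact, so a nearest
   point exists. *)
pose T := S `&` [set s | f s <= f 0].
have [c cT cmin] : exists2 c, c \in T & forall t, t \in T -> f c <= f t.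
  apply: EVT_min_rV.
  - by exists 0; split => /=.
  - apply: bounded_closed_compact; last first.
      apply: closedI => //.
      exact: (preimage_closed _ (@closed_le _ _)).
    (* Coordinates are bounded using [|u| <= u^2 + 1] and [u^2 <= f 0] for [u = s_j - v_j]. *)
    pose M := \sum_i `|v 0 i| + f 0 + 1.
    have f0_ge0 : 0 <= f 0 by apply: sumr_ge0 => i _; rewrite sqr_ge0.
    have v0_ge0 : 0 <= \sum_i `|v 0 i| by exact: sumr_ge0.
    exists M; split; first exact: num_real.
    move=> M' MM' s [_ /= sf]; apply: (le_trans _ (ltW MM')).
    rewrite /Num.Def.normr/= mx_normrE; apply: bigmax_le => [|[i j] _ /=].
      by rewrite /M; lra.
    rewrite ord1 /M.
    have : (s 0 j - v 0 j) ^+ 2 <= f 0.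
      apply: le_trans sf; rewrite /f (bigD1 j) //= lerDl.
      by apply: sumr_ge0 => k _; rewrite sqr_ge0.
    have : `|v 0 j| <= \sum_i `|v 0 i|.
      by rewrite (bigD1 j) //= lerDl; exact: sumr_ge0.
    move=> h1; rewrite -[_ ^+ 2]real_normK ?num_real // => h2.
    have := ler_normD (s 0 j - v 0 j) (v 0 j); rewrite subrK => h3.
    have := sqr_ge0 (`|s 0 j - v 0 j| - 1); rewrite sqrrB => h4.
    lra.
  - exact: continuous_subspaceT.
have Sc : S c by move: cT; rewrite inE => -[].
have {}cmin s : S s -> f c <= f s.
  move=> Ss; have [fs|/ltW fs] := leP (f s) (f 0).
    by apply: cmin; rewrite inE.
  by apply: le_trans fs; apply: cmin; rewrite inE; split => /=.
pose w := c - v.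
have f_line s t : f (c + t *: s) = f c + 2 * t * dot w s + t ^+ 2 * dot s s.
  rewrite /f /dot !mulr_sumr -!big_split; apply: eq_bigr => i _ /=.
  by rewrite !mxE; ring.
have dot_ge0 s : 0 <= dot s s by apply: sumr_ge0 => i _; rewrite -expr2 sqr_ge0.
have line_ge0 s t : S (c + t *: s) -> 0 <= 2 * t * dot w s + t ^+ 2 * dot s s.
  by move=> /cmin; rewrite f_line -addrA lerDl.
exists w; split=> [s Ss|].
  rewrite -/(dot w s) leNgt; apply/negP => ws_lt0.
  have := dot_ge0 s; set b := dot s s; set a := dot w s in ws_lt0 *.
  (* Minimality excludes this step: as [a = -t(b + 1)], [f] would change by [-t^2 (b + 2)]. The
     added 1 keeps the denominator positive. *)
  move=> b_ge0; pose t := - a / (b + 1).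
  have t_gt0 : 0 < t by rewrite divr_gt0; lra.
  have := line_ge0 s t (SD _ _ Sc (SZ _ _ (ltW t_gt0) Ss)).
  have at_ : a = - t * (b + 1) by rewrite /t; field; lra.
  rewrite -/a -/b at_; nra.
(* A step from [c] towards [0] stays in the cone while [t <= 1]; were [dot w c] positive, the chosen
   step would decrease [f]. *)
have wc : dot w c <= 0.
  rewrite leNgt; apply/negP; have := dot_ge0 c; set b := dot c c.
  set a := dot w c => b_ge0 a_gt0; pose t := a / (a + b).
  have t_gt0 : 0 < t by rewrite divr_gt0; lra.
  have t_le1 : t <= 1 by rewrite ler_pdivrMr; lra.
  have : S (c + - t *: c).
    have -> : c + - t *: c = (1 - t) *: c by rewrite scalerBl scale1r scaleNr.
    by apply: SZ => //; rewrite subr_ge0.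
  move=> /line_ge0; rewrite -/a -/b.
  have at_ : a = t * (a + b) by rewrite /t; field; lra.
  nra.
(* Thus [dot w v <= - dot w w], and [w] is nonzero since [c] lies in [S] and [v] does not. *)
have : dot w v = dot w c - dot w w.
  by rewrite /dot -sumrB; apply: eq_bigr => i _; rewrite !mxE; ring.
have : dot w w != 0.
  apply/negP; rewrite psumr_eq0 => [/allP w0|i _]; last first.
    by rewrite -expr2 sqr_ge0.
  apply: nSv; suff -> : v = c by [].
  apply/rowP => i; have := w0 i; rewrite mem_index_enum => /(_ isT).
  by rewrite /= mulf_eq0 orbb !mxE subr_eq0 => /eqP.
rewrite neq_lt ltNge dot_ge0 /= -/(dot w v) => ww ->; lra.
Qed.

End ConeSeparation.

(** * The bipolar theorem for cones of maps *)

Section Bipolar.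
Variable R : realType.
Local Notation C := (R[i]).

(** Separation is a real statement, so complex matrices get real coordinates: all real parts, then
    all imaginary parts. *)
Definition cplx_mx p q (x : 'rV[R]_(p * q + p * q)) : 'M[C]_(p, q) :=
  \matrix_(i, j) Complex (lsubmx x 0 (mxvec_index i j))
                         (rsubmx x 0 (mxvec_index i j)).

Lemma normc_le_ReIm (x y : R) : `|Complex x y| <= (`|x| + `|y|)%:C%C.
Proof.
rewrite normc_def lecR /= -[leRHS]ger0_norm ?addr_ge0 //.
rewrite -sqrtr_sqr ler_sqrt ?sqr_ge0 //.
rewrite -(real_normK (num_real x)) -(real_normK (num_real y)).
have := mulr_ge0 (normr_ge0 x) (normr_ge0 y); nra.
Qed.

Lemma cplx_mx_continuous p q : continuous (@cplx_mx p q).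
Proof.
move=> x A /nbhs_ballP[e /= e0 eA].
(* A positive [e] in [R[i]] is real; half of it is allotted to each of the real and imaginary
   parts. *)
have [d d0 ed] : exists2 d : R, 0 < d & e = (d + d)%:C%C.
  exists (complex.Re e / 2).
    by rewrite divr_gt0 //; move: e0; rewrite ltcE => /andP[].
  move: e0; rewrite ltcE => /andP[/eqP /= e0 _].
  by rewrite -splitr; apply/eqP; rewrite eq_complex /= e0 !eqxx.
apply/nbhs_ballP; exists d => //= y [_ xy]; apply: eA; split=> // i j.
rewrite !mxE -ball_normE /= ed.
apply: le_lt_trans (normc_le_ReIm _ _) _; rewrite ltcR.
by apply: ltrD; [have := xy 0 (lshift _ (mxvec_index i j))|
  have := xy 0 (rshift _ (mxvec_index i j))]; rewrite -ball_normE.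
Qed.

Lemma trmx_continuous p q : continuous (@trmx C p q).
Proof.
move=> x A /nbhs_ballP[e /= e0 eA]; apply/nbhs_ballP; exists e => //= y [_ xy].
by apply: eA; split=> // i j; rewrite !mxE.
Qed.

Lemma lin_mx_index m n (phi : 'Hom('M[C]_m, 'M[C]_n)) i j k l :
  lin_mx phi (mxvec_index i j) (mxvec_index k l) = phi (delta_mx i j) k l.
Proof. by rewrite mxE /= vec_mx_delta mxvecE. Qed.

Lemma lin_mx_inj m n :
  injective (fun phi : 'Hom('M[C]_m, 'M[C]_n) => lin_mx phi).
Proof.
move=> phi psi e; apply/lfunP => a.
by rewrite -[phi a]mx_vec_lin e mx_vec_lin.
Qed.

Definition hom_of_mx m n (M : 'M[C]_(m * m, n * n)) : 'Hom('M[C]_m, 'M[C]_n) :=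
  linfun (vec_mx \o mulmxr M \o mxvec).

Lemma hom_of_mxE m n (M : 'M[C]_(m * m, n * n)) a :
  hom_of_mx M a = vec_mx (mxvec a *m M).
Proof. by rewrite lfunE. Qed.

Lemma hom_of_mxK m n (M : 'M[C]_(m * m, n * n)) : lin_mx (hom_of_mx M) = M.
Proof.
apply/row_matrixP => i; rewrite !rowE mul_rV_lin /= hom_of_mxE.
by rewrite !vec_mxK.
Qed.

Lemma lin_mxK m n (phi : 'Hom('M[C]_m, 'M[C]_n)) : hom_of_mx (lin_mx phi) = phi.
Proof. exact/lin_mx_inj/hom_of_mxK. Qed.

Lemma hompair_lin_mx m n (phi psi : 'Hom('M[C]_m, 'M[C]_n)) :
  hompair phi psi = \sum_i \sum_j lin_mx phi i j * lin_mx psi i j.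
Proof.
rewrite hompairE [RHS](reindex _ (curry_mxvec_bij _ _)).
apply: eq_bigr => -[i j] _.
rewrite [RHS](reindex _ (curry_mxvec_bij _ _)); apply: eq_bigr => -[k l] _ /=.
by rewrite !lin_mx_index.
Qed.

Lemma hom_of_mxD m n (M N : 'M[C]_(m * m, n * n)) :
  hom_of_mx (M + N) = hom_of_mx M + hom_of_mx N.
Proof.
by apply/lfunP => a; rewrite add_lfunE !hom_of_mxE mulmxDr linearD.
Qed.

Lemma hom_of_mxZ m n c (M : 'M[C]_(m * m, n * n)) :
  hom_of_mx (c *: M) = c *: hom_of_mx M.
Proof.
by apply/lfunP => a; rewrite scale_lfunE !hom_of_mxE -scalemxAr linearZ.
Qed.

Lemma cplx_mxD p q (x y : 'rV[R]_(p * q + p * q)) :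
  cplx_mx (x + y) = cplx_mx x + cplx_mx y.
Proof. by apply/matrixP => i j; rewrite !mxE. Qed.

Lemma cplx_mxZ p q c (x : 'rV[R]_(p * q + p * q)) :
  cplx_mx (c *: x) = c%:C%C *: cplx_mx x.
Proof.
apply/matrixP => i j; rewrite !mxE.
by apply/eqP; rewrite eq_complex /= !mul0r subr0 addr0 !eqxx.
Qed.

Lemma cplx_mx_surj p q (M : 'M[C]_(p, q)) : exists x, cplx_mx x = M.
Proof.
exists (row_mx (mxvec (map_mx (@complex.Re R) M))
               (mxvec (map_mx (@complex.Im R) M))).
apply/matrixP => i j; rewrite mxE row_mxKl row_mxKr !mxvecE !mxE.
by case: (M i j).
Qed.

Lemma dot_cplx_mx p q (w x : 'rV[R]_(p * q + p * q)) :
  \sum_i w 0 i * x 0 i =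
  complex.Re (\sum_i \sum_j cplx_mx x i j * (cplx_mx w i j)^*).
Proof.
rewrite big_split_ord /= !(reindex _ (curry_mxvec_bij _ _)) -big_split /=.
rewrite pair_bigA raddf_sum; apply: eq_bigr => -[i j] _ /=.
by rewrite !mxE /= mulrN opprK [in LHS]mulrC [X in _ + X]mulrC.
Qed.

(* [chi a = (psi a^* )^*]; adding it to [psi] makes [psi] Hermitian-preserving
   and doubles the real part of the pairing with a Hermitian-preserving map. *)
Lemma hermitian_part m n (psi : 'Hom('M[C]_m, 'M[C]_n)) :
  exists chi : 'Hom('M[C]_m, 'M[C]_n), hermitian_preserving (psi + chi) /\
  forall phi, hermitian_preserving phi -> hompair phi chi = (hompair phi psi)^*.
Proof.
pose g (a : 'M[C]_m) : 'M[C]_n := (psi (a^t*))^t*.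
have gL : linear g.
  move=> c a b; rewrite /g ctrmxD ctrmxZ linearD linearZ /= ctrmxD ctrmxZ.
  by rewrite conjCK.
pose F := GRing.isLinear.Build _ _ _ _ g gL.
pose G : {linear 'M[C]_m -> 'M[C]_n} := HB.pack g F.
have gE a : linfun G a = (psi (a^t*))^t* by rewrite lfunE.
exists (linfun G); split=> [a|phi hphi].
  by rewrite !add_lfunE !gE trmxCK ctrmxD trmxCK addrC.
rewrite /hompair rmorph_sum exchange_big; apply: eq_bigr => i _.
rewrite rmorph_sum; apply: eq_bigr => j _ /=.
by rewrite gE ctrmx_delta -mxpair_ctrmx (hermitian_preserving_delta _ _ hphi).
Qed.

(** The nontrivial inclusion of the bipolar theorem: a point outside [K] is separated in real
    coordinates, and the functional is realized as pairing with a Hermitian-preserving map. *)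
Lemma dual_coneK m n (K : set 'Hom('M[C]_m, 'M[C]_n)) phi :
  K `<=` @hermitian_maps R m n -> convex_cone K -> hom_closed K ->
  hermitian_preserving phi ->
  (forall psi, dual_cone K psi -> 0 <= hompair psi phi) -> K phi.
Proof.
move=> Kherm [K0 KD KZ] Kcl hphi phi_ge0; apply: contrapT => nKphi.
pose toHom x := hom_of_mx (@cplx_mx (m * m) (n * n) x).
have [v vE] := cplx_mx_surj (lin_mx phi).
have toHom_v : toHom v = phi by rewrite /toHom vE lin_mxK.
have [|||||w [w_ge0 w_lt0]] := @cone_separation R _ [set x | K (toHom x)] v.
- have -> : [set x | K (toHom x)] =
      @cplx_mx _ _ @^-1` [set lin_mx psi | psi in K].
    apply/seteqP; split=> x /=.
      by exists (toHom x) => //; exact: hom_of_mxK.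
    by move=> [psi Kpsi e]; rewrite /toHom -e lin_mxK.
  by apply: preimage_closed => // x _; exact: cplx_mx_continuous.
- rewrite /= /toHom (_ : cplx_mx 0 = 0 *: 0).
    by rewrite hom_of_mxZ scale0r.
  by rewrite scale0r; apply/matrixP => i j; rewrite !mxE.
- by move=> x y /= Kx Ky; rewrite /toHom cplx_mxD hom_of_mxD; exact: KD.
- by move=> c x c_ge0 /= Kx; rewrite /toHom cplx_mxZ hom_of_mxZ; exact: KZ.
- by rewrite /= toHom_v.
(* Conjugation turns the sesquilinear product of [dot_cplx_mx] into the bilinear pairing. *)
pose psi : 'Hom('M[C]_m, 'M[C]_n) := hom_of_mx (map_mx Num.conj (cplx_mx w)).
have dotE (x : 'rV_(_)) :
    \sum_i w 0 i * x 0 i = complex.Re (hompair (toHom x) psi).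
  rewrite dot_cplx_mx hompair_lin_mx !hom_of_mxK; congr complex.Re.
  by apply: eq_bigr => i _; apply: eq_bigr => j _; rewrite !mxE.
have [chi [hchi chiE]] := hermitian_part psi.
(* The pairing with [psi + chi] is a number plus its conjugate, hence real and twice the separating
   functional. *)
have pairE (x : 'rV_(_)) : hermitian_preserving (toHom x) ->
    hompair (toHom x) (psi + chi) = 2 * (\sum_i w 0 i * x 0 i)%:C%C.
  move=> hx; rewrite dotE -addcJ -[X in _ = _ + X]/(Num.conj _) -chiE //.
  rewrite /hompair -big_split; apply: eq_bigr => i _; rewrite -big_split.
  by apply: eq_bigr => j _; rewrite add_lfunE mxpairDr.
have : dual_cone K (psi + chi).
  split=> // xi Kxi; have [x xE] := cplx_mx_surj (lin_mx xi).
  have xiE : xi = toHom x by rewrite /toHom xE lin_mxK.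
  rewrite xiE pairE; last by rewrite -xiE; exact: Kherm.
  by rewrite mulr_ge0 // ler0c; apply: w_ge0; rewrite /= -xiE.
move=> /phi_ge0; rewrite hompairC -toHom_v pairE ?toHom_v //.
by rewrite pmulr_rge0 // ler0c leNgt w_lt0.
Qed.

End Bipolar.

(** * Mapping cones *)

Section MappingCones.
Variable R : realType.
Local Notation C := (R[i]).

Lemma adjoint_setE m n (K : set 'Hom('M[C]_m, 'M[C]_n)) phi :
  adjoint_set K phi <-> K (hom_adjoint phi).
Proof.
split=> [[psi Kpsi <-]|Kphi]; first by rewrite hom_adjointK.
by exists (hom_adjoint phi) => //; exact: hom_adjointK.
Qed.

Lemma adjoint_setK m n (K : set 'Hom('M[C]_m, 'M[C]_n)) :
  adjoint_set (adjoint_set K) = K.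
Proof.
by apply/seteqP; split=> phi; rewrite !adjoint_setE hom_adjointK.
Qed.

Lemma dual_cone_adjoint_set m n (K : set 'Hom('M[C]_m, 'M[C]_n)) :
  dual_cone (adjoint_set K) = adjoint_set (dual_cone K).
Proof.
apply/seteqP; split=> phi; rewrite adjoint_setE => -[hphi phi_ge0]; split.
- exact: hermitian_adjoint.
- move=> psi Kpsi; rewrite -hompair_adjoint hom_adjointK.
  by apply: phi_ge0; exists psi.
- by rewrite -[phi]hom_adjointK; exact: hermitian_adjoint.
- move=> _ [psi Kpsi <-]; rewrite -hompair_adjoint hom_adjointK.
  exact: phi_ge0.
Qed.

Lemma lin_mx_adjoint m n (phi : 'Hom('M[C]_m, 'M[C]_n)) :
  lin_mx (hom_adjoint phi) = (lin_mx phi)^T.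
Proof.
apply/matrixP => i j; case/mxvec_indexP: i => k l; case/mxvec_indexP: j => p q.
by rewrite [RHS]mxE !lin_mx_index hom_adjoint_delta.
Qed.

Lemma adjoint_closed_convex_cone m n (K : set 'Hom('M[C]_m, 'M[C]_n)) :
  closed_convex_cone_of_positive_maps K ->
  closed_convex_cone_of_positive_maps (adjoint_set K).
Proof.
move=> [Kherm Kpos [K0 KD KZ] Kcl]; split.
- by move=> _ [phi Kphi <-]; exact/hermitian_adjoint/Kherm.
- by move=> _ [phi Kphi <-]; exact/positive_adjoint/Kpos.
- split.
  + by rewrite adjoint_setE hom_adjoint0.
  + by move=> phi psi; rewrite !adjoint_setE hom_adjointD; exact: KD.
  + by move=> c phi c_ge0; rewrite !adjoint_setE hom_adjointZ; exact: KZ.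
(* Adjunction transposes the matrices of maps, and transposition is continuous. *)
- rewrite /hom_closed.
  have -> : [set lin_mx phi | phi in adjoint_set K] =
      trmx @^-1` [set lin_mx phi | phi in K].
    apply/seteqP; split=> M /=.
      move=> [_ [phi Kphi <-] <-]; exists phi => //.
      by rewrite lin_mx_adjoint trmxK.
    move=> [phi Kphi e]; exists (hom_adjoint phi); first by exists phi.
    by rewrite lin_mx_adjoint e trmxK.
  by apply: preimage_closed => // x _; exact: trmx_continuous.
Qed.

(** [alpha o phi^*] is the adjoint of [phi o alpha^*], and [alpha^*] is again completely
    positive. *)
Lemma right_left_mapping_cone m n (K : set 'Hom('M[C]_m, 'M[C]_n)) :
  right_mapping_cone K -> left_mapping_cone (adjoint_set K).
Proof.
move=> [HK KCP]; split; first exact: adjoint_closed_convex_cone.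
move=> _ [alpha CPalpha [_ [phi Kphi <-] <-]].
rewrite -[alpha]hom_adjointK -hom_adjoint_comp.
exists (phi \o hom_adjoint alpha)%VF => //; apply: KCP.
exists phi => //; exists (hom_adjoint alpha) => //.
exact: completely_positive_adjoint.
Qed.

Lemma left_right_mapping_cone m n (K : set 'Hom('M[C]_m, 'M[C]_n)) :
  left_mapping_cone K -> right_mapping_cone (adjoint_set K).
Proof.
move=> [HK KCP]; split; first exact: adjoint_closed_convex_cone.
move=> _ [_ [phi Kphi <-] [alpha CPalpha <-]].
rewrite -[alpha]hom_adjointK -hom_adjoint_comp.
exists (hom_adjoint alpha \o phi)%VF => //; apply: KCP.
by exists (hom_adjoint alpha); [exact: completely_positive_adjoint|exists phi].
Qed.

Lemma right_mapping_cone_adjoint m n (K : set 'Hom('M[C]_m, 'M[C]_n)) :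
  right_mapping_cone K <-> left_mapping_cone (adjoint_set K).
Proof.
split=> [|/left_right_mapping_cone]; first exact: right_left_mapping_cone.
by rewrite adjoint_setK.
Qed.

Lemma left_mapping_cone_adjoint m n (K : set 'Hom('M[C]_m, 'M[C]_n)) :
  left_mapping_cone K <-> right_mapping_cone (adjoint_set K).
Proof. by rewrite right_mapping_cone_adjoint adjoint_setK. Qed.

(** Forward, [<alpha, psi^* o phi> = <psi o alpha, phi>] with [psi o alpha] in [K], and [CP] is
    self-dual. Backward, take [alpha] to be the identity. *)
Lemma right_mapping_cone_dualP m n (K : set 'Hom('M[C]_m, 'M[C]_n)) phi :
  right_mapping_cone K -> hermitian_preserving phi ->
  dual_cone K phi <-> forall psi, K psi -> CP R m (hom_adjoint psi \o phi)%VF.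
Proof.
move=> [HK KCP] hphi; split=> [[_ phi_ge0] psi Kpsi|phi_CP].
  apply: CP_dual => alpha CPalpha; rewrite -hompair_compl.
  by apply: phi_ge0; apply: KCP; exists psi => //; exists alpha.
split=> // psi /phi_CP/CP_hompair_id.
by rewrite -hompair_compl comp_lfun1r.
Qed.

(** The criterion for [psi] in the dual makes [phi^* o psi] completely positive, and its adjoint is
    [psi^* o phi]. The converse is the bipolar theorem. *)
Lemma right_mapping_cone_bidualP m n (K : set 'Hom('M[C]_m, 'M[C]_n)) phi :
  closed_convex_cone_of_positive_maps K ->
  (forall phi, hermitian_preserving phi ->
    dual_cone K phi <->
    forall psi, K psi -> CP R m (hom_adjoint psi \o phi)%VF) ->
  hermitian_preserving phi ->
  K phi <-> forall psi, dual_cone K psi -> CP R m (hom_adjoint psi \o phi)%VF.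
Proof.
move=> [Kherm _ Kcone Kcl] dualP hphi; split=> [Kphi psi Kpsi|phi_CP].
  have [hpsi _] := Kpsi.
  have /(_ phi Kphi)/completely_positive_adjoint := (dualP psi hpsi).1 Kpsi.
  by rewrite hom_adjoint_comp hom_adjointK.
apply: dual_coneK => // psi /phi_CP/CP_hompair_id.
by rewrite -hompair_compl comp_lfun1r.
Qed.

(** By associativity [psi^* o (phi o alpha)] is [psi^* o phi] followed on the right by [alpha], a
    composite of completely positive maps. *)
Lemma bidual_right_mapping_cone m n (K : set 'Hom('M[C]_m, 'M[C]_n)) :
  closed_convex_cone_of_positive_maps K ->
  (forall phi, hermitian_preserving phi ->
    K phi <->
    forall psi, dual_cone K psi -> CP R m (hom_adjoint psi \o phi)%VF) ->
  right_mapping_cone K.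
Proof.
move=> HK bidualP; split=> // _ [phi Kphi [alpha CPalpha <-]].
have [Kherm _ _ _] := HK; have hphi := Kherm _ Kphi.
apply/bidualP.
  by apply: hermitian_comp => //; exact: completely_positive_hermitian.
move=> psi Kpsi; rewrite comp_lfunA; apply: completely_positive_comp => //.
exact: (bidualP phi hphi).1.
Qed.

(** [phi o psi^*] and its adjoint [psi o phi^*] are completely positive together. Two sets [P] and
    [Q] allow [K] and its dual in either role. *)
Lemma dualP_adjoint m n (P Q : set 'Hom('M[C]_m, 'M[C]_n)) :
  (forall phi, hermitian_preserving phi ->
    P phi <-> forall psi, Q psi -> CP R n (phi \o hom_adjoint psi)%VF) <->
  (forall phi, hermitian_preserving phi ->
    adjoint_set P phi <->
    forall psi, adjoint_set Q psi -> CP R n (hom_adjoint psi \o phi)%VF).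
Proof.
have E phi : (forall psi, Q psi -> CP R n (phi \o hom_adjoint psi)%VF) <->
  (forall psi, adjoint_set Q psi ->
    CP R n (hom_adjoint psi \o hom_adjoint phi)%VF).
  split=> [phi_CP _ [psi Qpsi <-]|phi_CP psi Qpsi].
    by rewrite -hom_adjoint_comp; exact/completely_positive_adjoint/phi_CP.
  rewrite -[X in CP _ _ X]hom_adjointK hom_adjoint_comp.
  by apply/completely_positive_adjoint/phi_CP; exists psi.
split=> PQ phi hphi.
  rewrite adjoint_setE PQ; last exact: hermitian_adjoint.
  by rewrite E hom_adjointK.
by rewrite E -PQ ?adjoint_setE ?hom_adjointK //; exact: hermitian_adjoint.
Qed.

End MappingCones.

Theorem theorem2p4 (R : realType) (m n : nat)
    (K : set 'Hom('M[R[i]]_m, 'M[R[i]]_n))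
    (HK : closed_convex_cone_of_positive_maps K) :
  [<-> right_mapping_cone K;
       left_mapping_cone (adjoint_set K);
       (forall phi : 'Hom('M[R[i]]_m, 'M[R[i]]_n), hermitian_maps phi ->
         (dual_cone K phi <->
          forall psi, K psi -> CP R m (hom_adjoint psi \o phi)%VF));
       (forall phi : 'Hom('M[R[i]]_m, 'M[R[i]]_n), hermitian_maps phi ->
         (K phi <->
          forall psi, dual_cone K psi -> CP R m (hom_adjoint psi \o phi)%VF))]
  /\
  [<-> left_mapping_cone K;
       right_mapping_cone (adjoint_set K);
       (forall phi : 'Hom('M[R[i]]_m, 'M[R[i]]_n), hermitian_maps phi ->
         (dual_cone K phi <->
          forall psi, K psi -> CP R n (phi \o hom_adjoint psi)%VF));
       (forall phi : 'Hom('M[R[i]]_m, 'M[R[i]]_n), hermitian_maps phi ->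
         (K phi <->
          forall psi, dual_cone K psi -> CP R n (phi \o hom_adjoint psi)%VF))].
Proof.
have HK' := adjoint_closed_convex_cone HK.
split; tfae.
- exact: right_left_mapping_cone.
- by move=> /right_mapping_cone_adjoint rK phi; exact: right_mapping_cone_dualP.
- by move=> dualP phi; exact: right_mapping_cone_bidualP.
- exact: bidual_right_mapping_cone.
- exact: left_right_mapping_cone.
(* From here on the first cycle is applied to [adjoint_set K], whose dual is the adjoint of the dual
   of [K], and the criteria are carried back by adjunction. *)
- move=> rK; apply/dualP_adjoint => phi; rewrite -dual_cone_adjoint_set.
  exact: right_mapping_cone_dualP.
- move=> /dualP_adjoint; rewrite -dual_cone_adjoint_set => dualP.
  apply/dualP_adjoint => phi; rewrite -dual_cone_adjoint_set.
  exact: right_mapping_cone_bidualP.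
- move=> /dualP_adjoint; rewrite -dual_cone_adjoint_set => bidualP.
  exact/left_mapping_cone_adjoint/bidual_right_mapping_cone.
Qed.
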